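(* Consider the ordered-partitions merging problem described in the context on $N$ partitions. Let the optimal solution with cost threshold $C_{OPT}$ require space $OPT[N,C_{OPT}]=S_{OPT}$. Then, for any fixed $\epsilon>0$, there exists a polynomial algorithm that finds a solution (a set of contiguous merges covering all $N$ partitions) of total space at most $S_{OPT}$ and total cost at most $(1+N\epsilon)C_{OPT}$, in time $O\big(N^2(N+\tfrac1\epsilon)\big)$. For $\epsilon=\frac1N$ this gives a $(1,2)$ bi-criteria approximation of $(S_{OPT},C_{OPT})$ (total space at most $S_{OPT}$ and total cost at most $2C_{OPT}$) in time $O(N^3)$.
   Context: Ordered partitions. There is a time-ordered finite collection of files $R$, each with a size $|R|$ (its number of records). There are $N$ distinct partitions; each partition $P_i$ has a start time $s(P_i)$ and an end time $e(P_i)$ and is the set of files lying in that time range, and has an access frequency $\rho(P_i)\ge0$. The partitions are indexed $P_1,\dots,P_N$ in order of their end times ($P_1$ has the earliest end time). A merge $\mathcal{M}$ is a non-empty set of partitions; its span is $Sp(\mathcal{M})=\sum_{R\in\bigcup_{P\in\mathcal{M}}P}|R|$ (shared files counted once), its access frequency is $\rho(\mathcal{M})=\sum_{P\in\mathcal{M}}\rho(P)$, and its (expected read) cost is $C(\mathcal{M})=Sp(\mathcal{M})\rho(\mathcal{M})$. Only contiguous merges $[P_j,P_{j+1},\dots,P_i]$ with $1\le j\le i\le N$ are considered, and all of these are allowed. A solution is a set $Z$ of contiguous merges such that every $P_1,\dots,P_N$ belongs to at least one merge in $Z$; its total space is $\sum_{\mathcal{M}\in Z}Sp(\mathcal{M})$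 and its total cost is $\sum_{\mathcal{M}\in Z}C(\mathcal{M})$. $OPT[N,C_{OPT}]$ denotes the minimum total space of a solution whose total cost is at most $C_{OPT}$ (assumed to exist). Running time counts elementary arithmetic operations and comparisons, with the spans and costs of the contiguous merges available as input. *)

(* Defs.v *)
From mathcomp Require Import all_boot all_order all_algebra.
From mathcomp Require Import reals.
Set Implicit Arguments.
Unset Strict Implicit.
Unset Printing Implicit Defensive.
Import Order.TTheory GRing.Theory Num.Theory.
Local Open Scope ring_scope.

(** * Ordered partitions and contiguous merges *)

(* Files are numbered in time order and partitions in order of end time, both
   from 0. *)
Record problem (R : realType) (N : nat) := Problem {
  nfiles : nat;
  file_time : 'I_nfiles -> R;
  file_time_sorted :
    forall f g : 'I_nfiles, (f <= g)%N -> file_time f <= file_time g;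
  file_size : 'I_nfiles -> nat;
  part_start : 'I_N -> R;
  part_end : 'I_N -> R;
  part_end_sorted :
    forall i j : 'I_N, (i <= j)%N -> part_end i <= part_end j;
  part_freq : 'I_N -> R;
  part_freq_ge0 : forall i : 'I_N, 0 <= part_freq i;
  part_distinct :
    injective (fun i : 'I_N =>
      [set f : 'I_nfiles | part_start i <= file_time f <= part_end i])
}.

Definition part (R : realType) (N : nat) (I : problem R N) (i : 'I_N) :
    {set 'I_(nfiles I)} :=
  [set f | part_start I i <= file_time f <= part_end I i].

(* A merge is a set of partitions, given by their indices: the partitions are
   pairwise distinct, so nothing is identified. *)
Definition span (R : realType) (N : nat) (I : problem R N) (M : {set 'I_N}) :
    nat :=
  (\sum_(f in \bigcup_(i in M) part I i) file_size f)%N.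

Definition freq (R : realType) (N : nat) (I : problem R N) (M : {set 'I_N}) :
    R :=
  \sum_(i in M) part_freq I i.

Definition cost (R : realType) (N : nat) (I : problem R N) (M : {set 'I_N}) :
    R :=
  (span I M)%:R * freq I M.

Definition contig (N j i : nat) : {set 'I_N} := [set k : 'I_N | (j <= k <= i)%N].

Definition contiguous (N : nat) (M : {set 'I_N}) : bool :=
  [exists j : 'I_N, exists i : 'I_N, (j <= i)%N && (M == contig N j i)].

Definition solution (N : nat) (Z : {set {set 'I_N}}) : Prop :=
  (forall M, M \in Z -> contiguous M) /\
  (forall i : 'I_N, exists2 M, M \in Z & i \in M).

Definition total_space (R : realType) (N : nat) (I : problem R N)
    (Z : {set {set 'I_N}}) : nat :=
  (\sum_(M in Z) span I M)%N.

Definition total_cost (R : realType) (N : nat) (I : problem R N)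
    (Z : {set {set 'I_N}}) : R :=
  \sum_(M in Z) cost I M.

(* [is_OPT I C S]: the minimum total space under cost threshold [C] exists and
   equals [S]. *)
Definition is_OPT (R : realType) (N : nat) (I : problem R N) (C : R) (S : nat) :
    Prop :=
  (exists Z, [/\ solution Z, total_cost I Z <= C & total_space I Z = S]) /\
  (forall Z, solution Z -> total_cost I Z <= C -> (S <= total_space I Z)%N).

(** * A real random-access machine

   Programs are closed syntax containing no real constant other than 0 and 1,
   so a program cannot depend on the input size, on [eps] or on the instance.
   Memory consists of natural-number and real scalars and of two-dimensional
   arrays of each kind; variables and arrays are named by fixed numerals, array
   subscripts are computed.  The machine has no rounding, and no conversion
   between reals and naturals.  Every node of an evaluated expression, every
   assignment and every branch takes one unit of time. *)

Inductive nexp : Type :=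
| NConst of nat
| NVar of nat
| NGet of nat & nexp & nexp
| NAdd of nexp & nexp
| NSub of nexp & nexp.

Inductive rexp : Type :=
| RZero
| ROne
| RVar of nat
| RGet of nat & nexp & nexp
| RAdd of rexp & rexp
| RSub of rexp & rexp
| RMul of rexp & rexp
| RDiv of rexp & rexp.

Inductive bexp : Type :=
| NLe of nexp & nexp
| RLe of rexp & rexp
| BNot of bexp
| BAnd of bexp & bexp.

Inductive cmd : Type :=
| Skip
| NSet of nat & nexp
| NPut of nat & nexp & nexp & nexp
| RSet of nat & rexp
| RPut of nat & nexp & nexp & rexp
| Seq of cmd & cmd
| If of bexp & cmd & cmd
| While of bexp & cmd.

Record state (R : realType) := State {
  nvar : nat -> nat;
  narr : nat -> nat -> nat -> nat;
  rvar : nat -> R;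
  rarr : nat -> nat -> nat -> R
}.

Definition upd (T : Type) (f : nat -> T) (x : nat) (v : T) : nat -> T :=
  fun y => if y == x then v else f y.

Definition upd3 (T : Type) (f : nat -> nat -> nat -> T) (a i j : nat) (v : T) :
    nat -> nat -> nat -> T :=
  upd f a (upd (f a) i (upd (f a i) j v)).

Definition set_nvar (R : realType) (s : state R) (x v : nat) : state R :=
  State (upd (nvar s) x v) (narr s) (rvar s) (rarr s).

Definition set_narr (R : realType) (s : state R) (a i j v : nat) : state R :=
  State (nvar s) (upd3 (narr s) a i j v) (rvar s) (rarr s).

Definition set_rvar (R : realType) (s : state R) (x : nat) (v : R) : state R :=
  State (nvar s) (narr s) (upd (rvar s) x v) (rarr s).

Definition set_rarr (R : realType) (s : state R) (a i j : nat) (v : R) :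
    state R :=
  State (nvar s) (narr s) (rvar s) (upd3 (rarr s) a i j v).

Fixpoint neval (R : realType) (s : state R) (e : nexp) : nat :=
  match e with
  | NConst n => n
  | NVar x => nvar s x
  | NGet a e1 e2 => narr s a (neval s e1) (neval s e2)
  | NAdd e1 e2 => (neval s e1 + neval s e2)%N
  | NSub e1 e2 => (neval s e1 - neval s e2)%N
  end.

Fixpoint reval (R : realType) (s : state R) (e : rexp) : R :=
  match e with
  | RZero => 0
  | ROne => 1
  | RVar x => rvar s x
  | RGet a e1 e2 => rarr s a (neval s e1) (neval s e2)
  | RAdd e1 e2 => reval s e1 + reval s e2
  | RSub e1 e2 => reval s e1 - reval s e2
  | RMul e1 e2 => reval s e1 * reval s e2
  | RDiv e1 e2 => reval s e1 / reval s e2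
  end.

Fixpoint beval (R : realType) (s : state R) (b : bexp) : bool :=
  match b with
  | NLe e1 e2 => (neval s e1 <= neval s e2)%N
  | RLe e1 e2 => reval s e1 <= reval s e2
  | BNot b1 => ~~ beval s b1
  | BAnd b1 b2 => beval s b1 && beval s b2
  end.

Fixpoint ntime (e : nexp) : nat :=
  match e with
  | NConst _ | NVar _ => 1%N
  | NGet _ e1 e2 | NAdd e1 e2 | NSub e1 e2 => (ntime e1 + ntime e2).+1
  end.

Fixpoint rtime (e : rexp) : nat :=
  match e with
  | RZero | ROne | RVar _ => 1%N
  | RGet _ e1 e2 => (ntime e1 + ntime e2).+1
  | RAdd e1 e2 | RSub e1 e2 | RMul e1 e2 | RDiv e1 e2 =>
      (rtime e1 + rtime e2).+1
  end.

Fixpoint btime (b : bexp) : nat :=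
  match b with
  | NLe e1 e2 => (ntime e1 + ntime e2).+1
  | RLe e1 e2 => (rtime e1 + rtime e2).+1
  | BNot b1 => (btime b1).+1
  | BAnd b1 b2 => (btime b1 + btime b2).+1
  end.

(* [exec c s t s']: started in [s], [c] halts in [s'] after time [t].  The
   relation is deterministic. *)
Inductive exec (R : realType) : cmd -> state R -> nat -> state R -> Prop :=
| exec_skip s : exec Skip s 1%N s
| exec_nset s x e :
    exec (NSet x e) s (ntime e).+1 (set_nvar s x (neval s e))
| exec_nput s a e1 e2 e :
    exec (NPut a e1 e2 e) s (ntime e1 + ntime e2 + ntime e).+1
      (set_narr s a (neval s e1) (neval s e2) (neval s e))
| exec_rset s x e :
    exec (RSet x e) s (rtime e).+1 (set_rvar s x (reval s e))
| exec_rput s a e1 e2 e :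
    exec (RPut a e1 e2 e) s (ntime e1 + ntime e2 + rtime e).+1
      (set_rarr s a (neval s e1) (neval s e2) (reval s e))
| exec_seq c1 c2 s t1 s1 t2 s2 :
    exec c1 s t1 s1 -> exec c2 s1 t2 s2 -> exec (Seq c1 c2) s (t1 + t2)%N s2
| exec_if b c1 c2 s t s1 :
    exec (if beval s b then c1 else c2) s t s1 ->
    exec (If b c1 c2) s (btime b + t).+1 s1
| exec_while_end b c s :
    ~~ beval s b -> exec (While b c) s (btime b).+1 s
| exec_while_step b c s t1 s1 t2 s2 :
    beval s b -> exec c s t1 s1 -> exec (While b c) s1 t2 s2 ->
    exec (While b c) s (btime b + t1 + t2).+1 s2.

(** * Input and output conventions *)

(* Natural variable 0 holds [N], real variables 0 and 1 hold [eps] and the cost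
   threshold, and the entries (j, i), j <= i < N, of the real arrays 0 and 1 hold
   the span and the cost of the merge of partitions j to i.  All other cells are
   initially 0. *)
Definition input (R : realType) (N : nat) (I : problem R N) (eps C : R) :
    state R :=
  State
    (fun x => if x == 0%N then N else 0%N)
    (fun _ _ _ => 0%N)
    (fun x => if x == 0%N then eps else if x == 1%N then C else 0)
    (fun a j i =>
       if (j <= i < N)%N then
         if a == 0%N then (span I (contig N j i))%:R
         else if a == 1%N then cost I (contig N j i)
         else 0
       else 0).

(* Natural variable 1 holds the number of merges returned, and row k of the
   natural array 0 the two end points of the k-th one. *)
Definition out_merges (R : realType) (s : state R) : seq (nat * nat) :=
  [seq (narr s 0 k 0, narr s 0 k 1) | k <- iota 0 (nvar s 1)]%N.

Definition output (R : realType) (N : nat) (s : state R)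
    (Z : {set {set 'I_N}}) : Prop :=
  all (fun p => (p.1 <= p.2 < N)%N) (out_merges s) /\
  Z = [set M | M \in [seq contig N p.1 p.2 | p <- out_merges s]].

Definition returns (R : realType) (N : nat) (prog : cmd) (I : problem R N)
    (eps C : R) (t : nat) (Z : {set {set 'I_N}}) : Prop :=
  exists2 s, exec prog (input I eps C) t s & output s Z.

(* Main.v *)
(* Overlaps in a covering can be cut away without increasing any span or cost,
   so it suffices to consider tilings of the index range by intervals.  Put
   delta = eps * C_OPT and L = floor (1 / eps), and give each merge the least
   level a with cost <= (a + 1) * delta.  Levels times delta are below the
   costs, so the optimal solution has total level at most L; conversely a tiling has at
   most N merges, so a total level at most L bounds its cost by
   (L + N) * delta <= (1 + N * eps) * C_OPT.  Dynamic programming over (last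
   index, total level <= L, start of the last interval) thus finds a tiling of
   least space in O(N^2 * (N + L)) steps; the levels are computed by repeated
   addition of delta, at O(L) each.  When C_OPT = 0, the level of a free merge
   is still 0 and that of any other merge is L + 1, which excludes it. *)

Require Import Defs.
From mathcomp Require Import all_boot all_order all_algebra.
From mathcomp Require Import reals.
From mathcomp Require Import zify.
Set Implicit Arguments.
Unset Strict Implicit.
Unset Printing Implicit Defensive.
Import Order.TTheory GRing.Theory Num.Theory.
Local Open Scope ring_scope.

(** * Timed execution of programs *)

Section TimedHoareLogic.
Variable R : realType.
Implicit Types (s : state R) (c : cmd) (Q : state R -> Prop).

(** [T] is only an upper bound on the time, so the budgets below carry slack. *)
Definition wp c (T : nat) Q s :=
  exists t s', [/\ exec c s t s', (t <= T)%N & Q s'].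

Lemma wp_mono c T T' Q Q' s :
  wp c T Q s -> (forall s', Q s' -> Q' s') -> (T <= T')%N -> wp c T' Q' s.
Proof.
move=> [t [s' [h1 h2 h3]]] hQ hT; exists t, s'; split=> //; last exact: hQ.
exact: leq_trans hT.
Qed.

Lemma wp_skip Q s T : Q s -> (0 < T)%N -> wp Skip T Q s.
Proof. by exists 1%N, s; split=> //; constructor. Qed.

Lemma wp_nset x e Q s T :
  Q (set_nvar s x (neval s e)) -> (ntime e < T)%N -> wp (NSet x e) T Q s.
Proof. by move=> h hT; eexists _, _; split; [constructor|exact: hT|]. Qed.

Lemma wp_nput a e1 e2 e Q s T :
  Q (set_narr s a (neval s e1) (neval s e2) (neval s e)) ->
  (ntime e1 + ntime e2 + ntime e < T)%N -> wp (NPut a e1 e2 e) T Q s.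
Proof. by move=> h hT; eexists _, _; split; [constructor|exact: hT|]. Qed.

Lemma wp_rset x e Q s T :
  Q (set_rvar s x (reval s e)) -> (rtime e < T)%N -> wp (RSet x e) T Q s.
Proof. by move=> h hT; eexists _, _; split; [constructor|exact: hT|]. Qed.

Lemma wp_rput a e1 e2 e Q s T :
  Q (set_rarr s a (neval s e1) (neval s e2) (reval s e)) ->
  (ntime e1 + ntime e2 + rtime e < T)%N -> wp (RPut a e1 e2 e) T Q s.
Proof. by move=> h hT; eexists _, _; split; [constructor|exact: hT|]. Qed.

Lemma wp_seq T1 T2 c1 c2 Q s T :
  wp c1 T1 (wp c2 T2 Q) s -> (T1 + T2 <= T)%N -> wp (Seq c1 c2) T Q s.
Proof.
move=> [t1 [s1 [e1 h1 [t2 [s2 [e2 h2 hQ]]]]]] hT.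
exists (t1 + t2)%N, s2; split=> //; first exact: exec_seq e1 e2.
by apply: leq_trans hT; apply: leq_add.
Qed.

Lemma wp_if T1 b c1 c2 Q s T :
  (beval s b -> wp c1 T1 Q s) -> (~~ beval s b -> wp c2 T1 Q s) ->
  (btime b + T1 < T)%N -> wp (If b c1 c2) T Q s.
Proof.
move=> h1 h2 hT.
have [t [s' [e ht hQ]]] : wp (if beval s b then c1 else c2) T1 Q s.
  by case: ifPn.
exists (btime b + t).+1, s'; split=> //; first exact: exec_if.
by apply: leq_trans hT; rewrite ltnS leq_add2l.
Qed.

(** The index [m] is a variant: it drops at each iteration, so there are at most [n] of them, and
    the extra factor pays for the final test. *)
Lemma wp_while (Inv : nat -> state R -> Prop) n T1 b c Q s T :
  (forall m s, Inv m s -> beval s b ->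
     wp c T1 (fun s' => exists2 m', (m' < m)%N & Inv m' s') s) ->
  (forall m s, Inv m s -> ~~ beval s b -> Q s) ->
  Inv n s -> (n.+1 * (btime b + T1).+1 <= T)%N -> wp (While b c) T Q s.
Proof.
move=> step fin; elim/ltn_ind: n s T => n IH s T inv hT.
have [hb|hb] := boolP (beval s b); last first.
  exists (btime b).+1, s; split; [exact: exec_while_end| |exact: (fin _ _ inv hb)].
  by move: hT; nia.
have [t1 [s1 [e1 h1 [m hm inv1]]]] := step _ _ inv hb.
have [t2 [s2 [e2 h2 hQ]]] := IH _ hm _ _ inv1 (leqnn _).
exists (btime b + t1 + t2).+1, s2; split=> //.
  exact: exec_while_step hb e1 e2.
by apply: leq_trans hT; move: hm h1 h2; nia.
Qed.

Definition For x e c :=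
  Seq (NSet x (NConst 0))
    (While (NLe (NAdd (NVar x) (NConst 1)) e)
       (Seq c (NSet x (NAdd (NVar x) (NConst 1))))).

(** The bound [e] is re-evaluated at each test, so the invariant has to fix its value. The terms
    [ntime e] and 11 pay for test, increment and initialisation. *)
Lemma wp_for (Inv : nat -> state R -> Prop) n T1 x e c Q s T :
  (forall i s, Inv i s -> neval s e = n) ->
  (forall i s, (i < n)%N -> nvar s x = i -> Inv i s ->
     wp c T1 (fun s' => nvar s' x = i /\ Inv i.+1 (set_nvar s' x i.+1)) s) ->
  Inv 0%N (set_nvar s x 0%N) -> (forall s, Inv n s -> Q s) ->
  (n.+1 * (ntime e + T1 + 11) <= T)%N -> wp (For x e c) T Q s.
Proof.
move=> he step inv0 fin hT.
pose WInv m s := exists i, [/\ nvar s x = i, Inv i s, (i <= n)%N & m = (n - i)%N].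
apply: (@wp_seq 2 (n.+1 * (ntime e + T1 + 9))); last by nia.
apply: wp_nset => //=.
apply: (@wp_while WInv n (T1 + 4)).
- move=> _ {inv0}s [i [hx inv hi ->]] /=; rewrite (he _ _ inv) hx addn1 => hin.
  apply: (@wp_seq T1 4) => //.
  apply: wp_mono (step _ _ hin hx inv) _ (leqnn _) => s' [hx' inv'].
  apply: wp_nset => //=; rewrite hx' addn1.
  exists (n - i.+1)%N; first by lia.
  by exists i.+1; rewrite /= /upd eqxx.
- move=> _ {inv0}s [i [hx inv hi _]] /=; rewrite (he _ _ inv) hx addn1 => hin.
  by apply: fin; have -> : n = i by lia.
- by exists 0%N; rewrite subn0 /= /upd eqxx.
- by rewrite /=; nia.
Qed.

End TimedHoareLogic.

Lemma upd3E (T : Type) (f : nat -> nat -> nat -> T) a i j v a' i' j' :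
  upd3 f a i j v a' i' j' =
  if [&& a' == a, i' == i & j' == j] then v else f a' i' j'.
Proof.
rewrite /upd3 /upd; case: eqP => [->|//].
by case: eqP => [->|//]; case: eqP => [->|//].
Qed.

(** * Levels and tilings *)

Section Levels.
Variables (R : realType) (delta : R) (L : nat).

(** [find] defaults to the length [L.+1] when no level up to [L] suffices; this exceeds every budget
    in use and so bans the merge. *)
Definition level (c : R) : nat :=
  find (fun a => c <= a.+1%:R * delta) (iota 0 L.+1).

Lemma level_size c : (level c <= L.+1)%N.
Proof. by rewrite -[L.+1](size_iota 0) find_size. Qed.

Lemma level_leq c a : (a <= L)%N -> c <= a.+1%:R * delta -> (level c <= a)%N.
Proof.
move=> aL ca; rewrite leqNgt; apply/negP => /(before_find 0%N).
by rewrite nth_iota // add0n ca.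
Qed.

Lemma level_ub c : (level c <= L)%N -> c <= (level c).+1%:R * delta.
Proof.
move=> cL; have hs : has (fun a => c <= a.+1%:R * delta) (iota 0 L.+1).
  by rewrite has_find size_iota.
by have := nth_find 0%N hs; rewrite nth_iota ?add0n.
Qed.

Lemma level_lb c : 0 <= c -> (level c)%:R * delta <= c.
Proof.
move=> c0; case E: (level c) => [|a]; first by rewrite mul0r.
(* Level [a.+1] means that [a] was rejected; for the default [L.+1] this is the rejection of [L]. *)
rewrite leNgt; apply/negP => /ltW h.
have aL : (a <= L)%N by rewrite -ltnS -E level_size.
by have := level_leq aL h; rewrite E ltnn.
Qed.

Lemma level_mono c c' : c <= c' -> (level c <= level c')%N.
Proof.
move=> cc'; have [h|h] := leqP (level c') L.
  by apply: level_leq => //; apply: le_trans cc' (level_ub h).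
exact: leq_trans (level_size c) h.
Qed.

End Levels.

Section Tilings.
Variables (sp lev : nat -> nat -> nat).

(* [tiled n k w]: the indices below [n] are tiled by intervals [j, i], with
   total level at most [k] and total space exactly [w]. *)
Inductive tiled : nat -> nat -> nat -> Prop :=
| tiled_nil k : tiled 0 k 0
| tiled_cons i j k w : (j <= i)%N -> (lev j i <= k)%N ->
    tiled j (k - lev j i) w -> tiled i.+1 k (w + sp j i).

Lemma tiled_nilP k w : tiled 0 k w -> w = 0%N.
Proof. by move=> h; inversion h. Qed.

Lemma tiled_consP i k w : tiled i.+1 k w ->
  exists j w', [/\ (j <= i)%N, (lev j i <= k)%N, tiled j (k - lev j i) w'
                 & w = (w' + sp j i)%N].
Proof. by move=> h; inversion h; subst; exists j, w0. Qed.

Lemma tiled_weaken i k k' w : tiled i k w -> (k <= k')%N -> tiled i k' w.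
Proof.
move=> h; elim: h k' => {i k w} [k k' _|i j k w ji lk _ IH k' kk'].
  exact: tiled_nil.
apply: tiled_cons => //; first exact: leq_trans kk'.
by apply: IH; rewrite leq_sub2r.
Qed.

Variable R : realType.

(* A table entry is a pair [(c, v)]: [c = 0] marks infeasibility, otherwise the
   last interval starts at [c.-1] and [v] is the space. *)
Definition optimal i k (c : nat) (v : R) :=
  ((0 < c)%N -> exists2 w, tiled i k w & v = w%:R) /\
  (forall w, tiled i k w -> (0 < c)%N /\ v <= w%:R).

(* As [optimal i.+1 k c v], for tilings whose last interval starts before [b]. *)
Definition cell i b k (c : nat) (v : R) :=
  ((0 < c)%N -> exists w,
     [/\ (c <= b)%N, (lev c.-1 i <= k)%N, tiled c.-1 (k - lev c.-1 i) w
       & v = (w + sp c.-1 i)%:R]) /\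
  (forall j w, (j < b)%N -> (lev j i <= k)%N -> tiled j (k - lev j i) w ->
     (0 < c)%N /\ v <= (w + sp j i)%:R).

Lemma cell0 i k v : cell i 0 k 0 v.
Proof. by split. Qed.

Lemma cell_full i k c v : cell i i.+1 k c v -> optimal i.+1 k c v.
Proof.
move=> [h1 h2]; split=> [/[dup] c0 /h1[w [ci lk t ->]]|w /tiled_consP].
  by exists (w + sp c.-1 i)%N => //; apply: tiled_cons => //; rewrite -ltnS prednK.
by move=> [j [w' [ji lk t ->]]]; apply: h2.
Qed.

Lemma optimal_nil k : optimal 0 k 1 0.
Proof.
split=> [_|w /tiled_nilP ->]; last by [].
by exists 0%N => //; exact: tiled_nil.
Qed.

(** Either the level of [[j, i]] does not fit, or the prefix is infeasible, or the stored value is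
    already no worse: start [j] cannot improve the entry. *)
Lemma cell_keep i j k c v c' v' : cell i j k c v ->
  ((lev j i <= k)%N -> optimal j (k - lev j i) c' v') ->
  ~~ [&& (lev j i <= k)%N, (0 < c')%N
       & ~~ ((0 < c)%N && (v <= v' + (sp j i)%:R))] ->
  cell i j.+1 k c v.
Proof.
move=> [h1 h2] h' cond; split=> [/h1[w [cj lk t ->]]|j' w].
  by exists w; split=> //; exact: leqW.
rewrite ltnS leq_eqVlt => /predU1P[-> lk t|]; last exact: h2.
have [_ /(_ _ t)[c'0 v'w]] := h' lk.
move: cond; rewrite lk c'0 /= negbK => /andP[-> hv]; split=> //.
by apply: le_trans hv _; rewrite natrD lerD2r.
Qed.

(** If an earlier start is feasible then [0 < c], so the new value is below [v] and hence below that
    of every earlier start. *)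
Lemma cell_replace i j k c v c' v' : cell i j k c v ->
  optimal j (k - lev j i) c' v' ->
  [&& (lev j i <= k)%N, (0 < c')%N
    & ~~ ((0 < c)%N && (v <= v' + (sp j i)%:R))] ->
  cell i j.+1 k j.+1 (v' + (sp j i)%:R).
Proof.
move=> [h1 h2] [o1 o2] /and3P[lk c'0 cond]; split=> [_|j' w].
  by have [w t ->] := o1 c'0; exists w; split; rewrite //= -natrD.
rewrite ltnS leq_eqVlt => /predU1P[-> _ t|lj' lk' t]; split=> //.
  by have [_ h] := o2 _ t; rewrite natrD lerD2r.
have [c0 vw] := h2 _ _ lj' lk' t.
by move: cond; rewrite c0 /= -ltNge => /ltW /le_trans; exact.
Qed.

End Tilings.

(** * The program *)

(* Memory layout:
   - natural variables: 1 number of merges output, 2 the top level [L],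
     3 [i], 4 [j], 5 [k], 6 the level being computed;
   - real variables: 3 [eps * C], 2 and 4 accumulators;
   - natural arrays: 1 the first components of the table entries, with row
     [i.+1] for the tilings ending with [i], 2 the levels;
   - real array 2: the second components of the table entries. *)

(** The accumulator runs one multiple of [eps] ahead of the counter, so the counter stops at the
    floor of [1 / eps] without any conversion from reals. *)
Definition top_level_cmd : cmd :=
  Seq (RSet 2 (RVar 0))
    (While (RLe (RVar 2) ROne)
       (Seq (NSet 2 (NAdd (NVar 2) (NConst 1)))
            (RSet 2 (RAdd (RVar 2) (RVar 0))))).

(** In row 0 the entry 1 encodes no start; it only marks the empty tiling as feasible. *)
Definition init_cmd : cmd :=
  For 5 (NAdd (NVar 2) (NConst 1)) (NPut 1 (NConst 0) (NVar 5) (NConst 1)).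

(** The second test stops the count at [L.+1], the default of [level], and ensures termination when
    the step is 0. *)
Definition level_cmd : cmd :=
  Seq (NSet 6 (NConst 0))
  (Seq (RSet 4 (RVar 3))
  (Seq (While (BAnd (BNot (RLe (RGet 1 (NVar 4) (NVar 3)) (RVar 4)))
                    (NLe (NVar 6) (NVar 2)))
         (Seq (NSet 6 (NAdd (NVar 6) (NConst 1)))
              (RSet 4 (RAdd (RVar 4) (RVar 3)))))
       (NPut 2 (NVar 4) (NVar 3) (NVar 6)))).

Definition cur_row : nexp := NAdd (NVar 3) (NConst 1).

Definition rest_level : nexp := NSub (NVar 5) (NVar 6).

Definition new_value : rexp :=
  RAdd (RGet 2 (NVar 4) rest_level) (RGet 0 (NVar 4) (NVar 3)).

(** When the level exceeds the budget, the truncated [rest_level] is 0 and the entry read there is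
    meaningless; the first test rejects this case. *)
Definition relax_cmd : cmd :=
  If (BAnd (NLe (NVar 6) (NVar 5))
     (BAnd (NLe (NConst 1) (NGet 1 (NVar 4) rest_level))
        (BNot (BAnd (NLe (NConst 1) (NGet 1 cur_row (NVar 5)))
                    (RLe (RGet 2 cur_row (NVar 5)) new_value)))))
    (Seq (RPut 2 cur_row (NVar 5) new_value)
         (NPut 1 cur_row (NVar 5) (NAdd (NVar 4) (NConst 1))))
    Skip.

Definition table_cmd : cmd :=
  For 3 (NVar 0)
    (For 4 (NAdd (NVar 3) (NConst 1))
      (Seq level_cmd (For 5 (NAdd (NVar 2) (NConst 1)) relax_cmd))).

(** Here natural variable 3 counts the indices still to be tiled, so the next interval ends at its
    predecessor. *)
Definition trace_cmd : cmd :=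
  Seq (NSet 3 (NVar 0))
  (Seq (NSet 5 (NVar 2))
    (While (NLe (NConst 1) (NVar 3))
      (Seq (NSet 4 (NSub (NGet 1 (NVar 3) (NVar 5)) (NConst 1)))
      (Seq (NPut 0 (NVar 1) (NConst 0) (NVar 4))
      (Seq (NPut 0 (NVar 1) (NConst 1) (NSub (NVar 3) (NConst 1)))
      (Seq (NSet 1 (NAdd (NVar 1) (NConst 1)))
      (Seq (NSet 5 (NSub (NVar 5)
                         (NGet 2 (NVar 4) (NSub (NVar 3) (NConst 1)))))
           (NSet 3 (NVar 4))))))))).

Definition merge_prog : cmd :=
  Seq top_level_cmd
  (Seq (RSet 3 (RMul (RVar 0) (RVar 1)))
  (Seq init_cmd (Seq table_cmd trace_cmd))).

(** * Correctness and cost of filling the table *)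

Section ProgramCorrectness.
Variables (R : realType) (N L : nat) (delta : R).
Variables (sp : nat -> nat -> nat) (cst : nat -> nat -> R).

Notation lev := (fun j i => level delta L (cst j i)).

Definition env (s : state R) :=
  [/\ nvar s 0 = N, nvar s 1 = 0%N, nvar s 2 = L, rvar s 3 = delta &
    forall j i, (j <= i < N)%N ->
      rarr s 0 j i = (sp j i)%:R /\ rarr s 1 j i = cst j i].

(* [P i] bounds the [j] for which the level of [j, i] has been stored, and
   [J i k] those which have been tried for the table entry [i.+1, k]. *)
Definition table_inv (P : nat -> nat) (J : nat -> nat -> nat) (s : state R) :=
  [/\ env s,
      forall k, (k <= L)%N -> narr s 1 0 k = 1%N /\ rarr s 2 0 k = 0,
      forall j i, (j < P i)%N -> narr s 2 j i = lev j i &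
      forall i k, (k <= L)%N ->
        cell sp lev i (J i k) k (narr s 1 i.+1 k) (rarr s 2 i.+1 k)].

Definition progress (i j : nat) : nat -> nat :=
  fun i' => if (i' < i)%N then i'.+1 else if i' == i then j else 0%N.

Lemma table_inv_ext P P' J J' s :
  (forall i, (P' i <= P i)%N) ->
  (forall i k, (k <= L)%N -> J' i k = J i k) ->
  table_inv P J s -> table_inv P' J' s.
Proof.
move=> hP hJ [h1 h2 h3 h4]; split=> // [j i ji|i k kL].
  by apply: h3; apply: leq_trans (hP i).
by rewrite hJ //; apply: h4.
Qed.

Lemma table_optimal P J s i k : table_inv P J s ->
  (forall i', (i' < i)%N -> J i' k = i'.+1) -> (k <= L)%N ->
  optimal sp lev i k (narr s 1 i k) (rarr s 2 i k).
Proof.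
move=> [_ h2 _ h4] hJ kL; case: i hJ => [_|i hJ].
  by have [-> ->] := h2 k kL; apply: optimal_nil.
by apply: cell_full; rewrite -[X in cell _ _ _ X](hJ i (ltnSn i)); apply: h4.
Qed.

Lemma relax_correct P J s i j k :
  (i < N)%N -> (j <= i)%N -> (k <= L)%N ->
  nvar s 3 = i -> nvar s 4 = j -> nvar s 5 = k -> nvar s 6 = lev j i ->
  J i k = j -> (forall i' k', (i' < i)%N -> J i' k' = i'.+1) ->
  table_inv P J s ->
  wp relax_cmd 100 (fun s' => nvar s' = nvar s /\
    table_inv P (fun i' k' => if (i' == i) && (k' == k) then j.+1 else J i' k')
      s') s.
Proof.
move=> iN ji kL e3 e4 e5 e6 eJ hJ inv.
have [hE h2 h3 h4] := inv; have [_ _ _ _ hA] := hE.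
have [hsp _] : rarr s 0 j i = (sp j i)%:R /\ rarr s 1 j i = cst j i.
  by apply: hA; rewrite ji.
have hcell := h4 i k kL; rewrite eJ in hcell.
(* Row [j <= i] concerns tilings ending before [i], for which all starts have been tried, so the
   prefix entry is final when read. *)
have hopt : (lev j i <= k)%N -> optimal sp lev j (k - lev j i)
    (narr s 1 j (k - lev j i)) (rarr s 2 j (k - lev j i)).
  move=> _; apply: (table_optimal inv); last by rewrite leq_subLR; lia.
  by move=> i' i'j; apply: hJ; apply: leq_trans ji.
apply: (@wp_if _ 50) => //=; rewrite /= ?e3 ?e4 ?e5 ?e6 ?addn1 hsp => cond.
- apply: (@wp_seq _ 25 25) => //; apply: wp_rput => //; apply: wp_nput => //=.
  split=> //; rewrite ?e3 ?e4 ?e5 ?e6 ?addn1 hsp; split=> /=.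
  + case: hE => E1 E2 E3 E4 E5; split=> //= a b /E5; rewrite !upd3E /=; exact.
  + by move=> k' /h2; rewrite !upd3E.
  + by move=> a b /h3; rewrite upd3E.
  + move=> i' k' k'L; rewrite !upd3E /= eqSS.
    case: (boolP (_ && _)) => [/andP[/eqP -> /eqP ->]|_]; last exact: h4.
    have /and3P[lk _ _] := cond.
    exact: cell_replace hcell (hopt lk) cond.
- apply: wp_skip => //; split=> //; split=> // i' k' k'L.
  case: (boolP (_ && _)) => [/andP[/eqP -> /eqP ->]|_]; last exact: h4.
  exact: cell_keep hcell hopt cond.
Qed.

Lemma level_correct P J s i j :
  (i < N)%N -> (j <= i)%N -> nvar s 3 = i -> nvar s 4 = j ->
  table_inv P J s -> P i = j ->
  wp level_cmd (40 * L.+2) (fun s' =>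
    [/\ nvar s' 3 = i, nvar s' 4 = j, nvar s' 6 = lev j i &
      table_inv (fun i' => if i' == i then j.+1 else P i') J s']) s.
Proof.
move=> iN ji e3 e4 inv Pi.
apply: (@wp_seq _ 2 (40 * L.+2 - 2)) => //; last by lia.
apply: wp_nset => //; apply: (@wp_seq _ 2 (40 * L.+2 - 4)) => //; last by lia.
apply: wp_rset => //.
apply: (@wp_seq _ (L.+2 * 25) 10) => //; last by lia.
pose WI m (s : state R) := exists a, [/\ nvar s 3 = i, nvar s 4 = j,
  table_inv P J s,
  [/\ nvar s 6 = a, rvar s 4 = a.+1%:R * delta & (a <= lev j i)%N]
  & (m + a = L.+1)%N].
apply: (@wp_while _ WI L.+1).
- move=> m {inv e3 e4}s [a [e3 e4 inv [e6 e4' al] ma]] /=.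
  rewrite e3 e4 e6 e4'; have [[E0 E1 E2 E3 E4] _ _ _] := inv.
  have jiN : (j <= i < N)%N by rewrite ji iN.
  have [_ ->] := E4 j i jiN; rewrite E2 => /andP[hc aL].
  apply: (@wp_seq _ 4 4) => //; apply: wp_nset => //; apply: wp_rset => //=.
  exists (m.-1); first by lia.
  exists a.+1; rewrite /upd /= e6 e4' E3 addn1; split=> //; last by lia.
  split=> //; first by rewrite [in RHS]mulrSr mulrDl mul1r.
  (* Were [a] already the level, [level_ub] would contradict the cost test. *)
  rewrite ltn_neqAle al andbT; apply/eqP => ea.
  by move/negP: hc; apply; rewrite ea level_ub // -ea.
- move=> m {inv e3 e4}s [a [e3 e4 inv [e6 e4' al] ma]] /=.
  rewrite e3 e4 e6 e4'; have [hE h2 h3 h4] := inv.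
  have [E0 E1 E2 E3 E4] := hE.
  have jiN : (j <= i < N)%N by rewrite ji iN.
  have [_ ->] := E4 j i jiN; rewrite E2 negb_and negbK => hc.
  have ea : a = lev j i.
    apply/eqP; rewrite eqn_leq al /=; case/orP: hc => [hc|].
      have [aL|aL] := leqP a L; first exact: level_leq.
      by apply: leq_trans (level_size _ _ _) aL.
    by rewrite -ltnNge => aL; apply: leq_trans (level_size _ _ _) aL.
  apply: wp_nput => //=; rewrite e3 e4 e6; split=> //=.
  split=> //= a' b; rewrite upd3E /=.
  case: (eqVneq b i) => [->|_]; rewrite ?andbT ?andbF; last exact: h3.
  by rewrite ltnS leq_eqVlt; case: eqVneq => [->|_ /= h] //; apply: h3; rewrite Pi.
- by exists 0%N; rewrite /= mul1r addn0; case: inv => -[E0 E1 E2 E3 E4] ? ? ?.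
- by rewrite /=; lia.
Qed.

Lemma table_correct s : table_inv (progress 0 0) (fun i _ => progress 0 0 i) s ->
  wp table_cmd (N.+1 * (N.+1 * (200 * L.+2) + 40))
    (table_inv (progress N 0) (fun i _ => progress N 0 i)) s.
Proof.
move=> inv.
apply: (@wp_for _
  (fun i => table_inv (progress i 0) (fun i' _ => progress i 0 i')) N
  (N.+1 * (200 * L.+2) + 20)) => //; last by rewrite /=; nia.
  by move=> i t [[]].
move=> i {inv}s iN e3 inv.
pose J2 j (s : state R) := nvar s 3 = i /\
  table_inv (progress i j) (fun i' _ => progress i j i') s.
apply: (@wp_for _ J2 i.+1 (180 * L.+2)) => //; last by rewrite /=; nia.
- by move=> j t [/= -> _]; rewrite addn1.
- move=> j {inv e3}s; rewrite ltnS => ji e4 [e3 inv].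
  apply: (@wp_seq _ (40 * L.+2) (140 * L.+2)); last by lia.
  have hPi : progress i j i = j by rewrite /progress ltnn eqxx.
  apply: wp_mono (level_correct iN ji e3 e4 inv hPi) _ (leqnn _).
  move=> {inv e3 e4}s [e3 e4 e6 inv].
  pose K k (s : state R) := [/\ nvar s 3 = i, nvar s 4 = j, nvar s 6 = lev j i &
    table_inv (progress i j.+1)
     (fun i' k' => if (i' == i) && (k' < k)%N then j.+1 else progress i j i') s].
  have hprog i' : progress i j.+1 i' = if i' == i then j.+1 else progress i j i'.
    by rewrite /progress; case: (ltngtP i' i).
  apply: (@wp_for _ K L.+1 100).
  + by move=> k t [/= _ _ _ [[_ _ -> _ _] _ _ _]]; rewrite addn1.
  + move=> k {inv e3 e4 e6}s; rewrite ltnS => kL e5 [e3 e4 e6 inv].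
    apply: wp_mono (relax_correct iN ji kL e3 e4 e5 e6 _ _ inv) _ (leqnn _).
    * by rewrite eqxx ltnn.
    * by move=> i' k' ii'; rewrite /progress ltn_eqF //= ii'.
    * move=> s' [ev inv']; rewrite ev; split=> //; split; rewrite /= ?ev //.
      apply: table_inv_ext inv' => // i' k' _.
      by case: eqP => //= _; rewrite ltnS leq_eqVlt; case: eqP.
  + split=> //; apply: table_inv_ext inv => [i'|i' k' _]; first by rewrite hprog.
    by rewrite andbF.
  + move=> t [e3' e4' e6' inv']; split=> //; split=> //.
    apply: table_inv_ext inv' => // i' k' kL.
    by rewrite hprog ltnS kL andbT.
  + by rewrite /=; lia.
(* Row [i] with all [i.+1] starts tried is the same progress as row [i.+1] with none. *)
- move=> t [e3' inv']; split=> //; apply: table_inv_ext inv' => [i'|i' k' _];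
  by rewrite /progress ltnS if_same; case: ltngtP => // ->.
Qed.

End ProgramCorrectness.

(** * The phases around the table: top level, first row, traceback *)

Section ProgramPhases.
Variables (R : realType) (N L : nat) (delta : R).
Variables (sp : nat -> nat -> nat) (cst : nat -> nat -> R).

Notation lev := (fun j i => level delta L (cst j i)).

Lemma top_level_correct (eps : R) s :
  0 < eps -> L%:R * eps <= 1 -> 1 < L.+1%:R * eps ->
  rvar s 0 = eps -> nvar s 2 = 0%N ->
  wp top_level_cmd (20 * L.+2) (fun s' =>
    [/\ nvar s' 2 = L, nvar s' 0 = nvar s 0, nvar s' 1 = nvar s 1,
        rvar s' 0 = rvar s 0 /\ rvar s' 1 = rvar s 1
      & narr s' = narr s /\ rarr s' = rarr s]) s.
Proof.
move=> eps0 epsL epsL1 e0 e2; apply: (@wp_seq _ 2 (L.+1 * 20)) => //; last by lia.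
apply: wp_rset => //.
pose WI m (s' : state R) := exists a,
  [/\ nvar s' 2 = a, rvar s' 2 = a.+1%:R * eps, (m + a = L)%N,
      [/\ nvar s' 0 = nvar s 0, nvar s' 1 = nvar s 1,
          rvar s' 0 = rvar s 0 & rvar s' 1 = rvar s 1]
    & narr s' = narr s /\ rarr s' = rarr s].
apply: (@wp_while _ WI L 10).
- move=> m s' [a [n2 r2 ma [h1 h2 h3 h4] [h5 h6]]] /=; rewrite r2 => ha.
  have aL : (a < L)%N.
    rewrite ltn_neqAle; apply/andP; split; last by lia.
    by apply/eqP => aL; move: ha; rewrite aL leNgt epsL1.
  apply: (@wp_seq _ 4 4) => //; apply: wp_nset => //; apply: wp_rset => //=.
  exists m.-1; first by lia.
  exists a.+1; rewrite /upd /= n2 r2 h3 e0 addn1; split=> //.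
  + by rewrite /upd [in RHS]mulrSr mulrDl mul1r.
  + by lia.
  + by rewrite /upd /= h1 h2 h4 h3 e0.
- move=> m s' [a [n2 r2 ma [h1 h2 h3 h4] h5]] /=; rewrite r2 -ltNge => ha.
  split=> //; rewrite n2; apply/eqP; rewrite eqn_leq -(ltnS L); apply/andP.
  split; first by rewrite -ma leq_addl.
  rewrite -(ltr_nat R) -(ltr_pM2r eps0); exact: le_lt_trans ha.
- by exists 0%N; rewrite /= /upd /= mul1r addn0.
- by rewrite /=; lia.
Qed.

Lemma init_correct s :
  env N L delta sp cst s -> (forall k, rarr s 2 0 k = 0) ->
  (forall i k, narr s 1 i.+1 k = 0%N) ->
  wp init_cmd (20 * L.+2)
    (table_inv N L delta sp cst (progress 0 0) (fun i _ => progress 0 0 i)) s.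
Proof.
move=> hE hr hn.
pose FI k (s' : state R) := [/\ env N L delta sp cst s',
  forall k', (k' < k)%N -> narr s' 1 0 k' = 1%N,
  forall k', rarr s' 2 0 k' = 0 & forall i k', narr s' 1 i.+1 k' = 0%N].
apply: (@wp_for _ FI L.+1 5).
- by move=> i t [[_ _ /= -> _ _] _ _ _]; rewrite addn1.
- move=> k s' kL e5 [h1 h2 h3 h4]; apply: wp_nput => //=; split=> //; split=> //=.
  move=> k'; rewrite upd3E /= e5 ltnS leq_eqVlt.
  by case: eqVneq => //= _ /h2.
- by split=> // k'; rewrite ltn0.
- move=> t [h1 h2 h3 h4]; have p0 i : progress 0 0 i = 0%N.
    by rewrite /progress /= if_same.
  split=> // [k kL|j i|i k kL]; rewrite ?p0 //; first by rewrite h2.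
  by rewrite h4; apply: cell0.
- by rewrite /=; lia.
Qed.

Lemma out_merges_rcons (s s' : state R) p :
  nvar s' 1 = (nvar s 1).+1 ->
  (forall k b, (k < nvar s 1)%N -> narr s' 0 k b = narr s 0 k b) ->
  (narr s' 0 (nvar s 1) 0%N, narr s' 0 (nvar s 1) 1%N) = p ->
  out_merges s' = rcons (out_merges s) p.
Proof.
move=> h1 h2 <-; rewrite /out_merges h1 -[(nvar s 1).+1]addn1 iotaD.
rewrite map_cat cats1 add0n.
congr rcons; apply/eq_in_map => k; rewrite mem_iota add0n => /andP[_ kn].
by rewrite !h2.
Qed.

(* The output [l] tiles the indices from [i] on, and some tiling of those below
   [i] fits in the level [k] and the space that remain. *)
Definition partial_output S i k (l : seq (nat * nat)) :=
  [/\ all (fun p => (p.1 <= p.2 < N)%N) l,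
      forall x, (i <= x < N)%N -> exists2 p, p \in l & (p.1 <= x <= p.2)%N,
      exists2 w, tiled sp lev i k w & (\sum_(p <- l) sp p.1 p.2 + w <= S)%N
    & (\sum_(p <- l) lev p.1 p.2 + k <= L)%N].

(** The remaining tiling of space [w] makes the entry feasible with value at most [w], so following
    the stored start preserves the bound [S]. *)
Lemma partial_output_step S i j k l (c : nat) (v : R) :
  (i < N)%N -> partial_output S i.+1 k l -> cell sp lev i i.+1 k c v ->
  j = c.-1 ->
  [/\ (j <= i)%N, (lev j i <= k)%N
    & partial_output S j (k - lev j i) (rcons l (j, i))].
Proof.
move=> iN [h1 h2 [w t hw] hk] hc ->.
have [_ /(_ _ t)[c0 vw]] := cell_full hc.
have [/(_ c0)[w' [cj lk t' ev]] _] := hc.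
have ci : (c.-1 <= i)%N by rewrite -ltnS prednK.
split=> //; split.
- by rewrite all_rcons /= ci iN h1.
- move=> x /andP[cx xN]; have [xi|ix] := leqP x i.
    by exists (c.-1, i); rewrite ?mem_rcons ?mem_head //= cx xi.
  have [|p pl hp] := h2 x; first by rewrite ix.
    by exists p => //; rewrite mem_rcons inE pl orbT.
- exists w' => //; rewrite -cats1 big_cat big_seq1 /=.
  by move: vw; rewrite ev ler_nat; lia.
- by rewrite -cats1 big_cat big_seq1 /=; lia.
Qed.

Lemma trace_correct S w s :
  table_inv N L delta sp cst (progress N 0) (fun i _ => progress N 0 i) s ->
  tiled sp lev N L w -> (w <= S)%N ->
  wp trace_cmd (50 * N.+1) (fun s' =>
    partial_output S 0 0 (out_merges s') /\ (size (out_merges s') <= N)%N) s.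
Proof.
move=> [[E0 E1 E2 _ _] _ hl hc] tw wS.
have hlev j i : (j <= i < N)%N -> narr s 2 j i = lev j i.
  by move=> /andP[ji iN]; apply: hl; rewrite /progress iN ltnS.
have hcell i k : (i < N)%N -> (k <= L)%N ->
    cell sp lev i i.+1 k (narr s 1 i.+1 k) (rarr s 2 i.+1 k).
  by move=> iN /(hc i); rewrite /progress iN.
apply: (@wp_seq _ 2 (50 * N.+1 - 2)) => //; last by lia.
apply: wp_nset => //; apply: (@wp_seq _ 2 (N.+1 * 44)) => //; last by lia.
apply: wp_nset => //.
(* Each step outputs one interval and lowers [m] by at least one, which bounds the output size by
   [N]. Only array 0 is written, so table and levels stay intact. *)
pose TI m (s' : state R) :=
  [/\ nvar s' 3 = m, (m <= N)%N, (nvar s' 1 + m <= N)%N,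
      (nvar s' 5 <= L)%N /\ partial_output S m (nvar s' 5) (out_merges s')
    & forall a, (0 < a)%N -> narr s' a = narr s a].
apply: (@wp_while _ TI N 36).
- move=> [|i] s' [e3 mN n1 [kL po] ha] /=; rewrite e3 // => _.
  have [ji lk po'] := partial_output_step mN po (hcell _ _ mN kL) erefl.
  move: ji lk po'; set j := _.-1 => ji lk po'.
  apply: (@wp_seq _ 6 30) => //; apply: wp_nset => //=.
  apply: (@wp_seq _ 4 26) => //; apply: wp_nput => //=.
  apply: (@wp_seq _ 6 20) => //; apply: wp_nput => //=.
  apply: (@wp_seq _ 4 16) => //; apply: wp_nset => //=.
  apply: (@wp_seq _ 10 6) => //; apply: wp_nset => //=.
  apply: wp_nset => //=.
  exists j => //; rewrite /upd3 /upd /= e3 subn1 /= !ha // subn1 -/j.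
  rewrite hlev ?ji //; split=> //=.
  + by apply: leq_trans ji (ltnW mN).
  + by rewrite /upd /=; lia.
  + rewrite {1 2}/upd /=; split; first by lia.
    rewrite (@out_merges_rcons s' _ (j, i)) //= ?addn1 ?subn1 ?e3 //=.
    * by move=> k b kn; rewrite !upd3E (ltn_eqF kn).
    * by rewrite !upd3E /= !eqxx.
  + by move=> a a0; rewrite /upd3 /upd (gtn_eqF a0) ha.
- move=> m s' [e3 mN n1 [kL [p1 p2 [w' t' hw] hk]] ha] /=; rewrite e3.
  case: m e3 p2 t' n1 mN => // _ p2 t' n1 _ _; split; last first.
    by rewrite size_map size_iota; lia.
  split=> //; last by lia.
  by exists w' => //; rewrite (tiled_nilP t'); exact: tiled_nil.
- split=> //=; rewrite /upd /= ?E1 ?addn0 ?E0 //.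
  rewrite E2; split=> //; rewrite /out_merges /= /upd /= E1; split=> //.
  + by move=> x; lia.
  + by exists w; rewrite // big_nil.
  + by rewrite big_nil.
- by rewrite /=; lia.
Qed.

End ProgramPhases.

(** * Approximation guarantee *)

Section Merges.
Variables (R : realType) (N : nat) (I : problem R N).
Implicit Types (M : {set 'I_N}) (Z : {set {set 'I_N}}).

Lemma span_sub M M' : M \subset M' -> (Defs.span I M <= Defs.span I M')%N.
Proof.
move=> /subsetP MM'; rewrite /Defs.span.
rewrite [leqRHS](big_setID (\bigcup_(i in M) part I i)) /=.
rewrite (setIidPr _) ?leq_addr //; apply/bigcupsP => i /MM' iM'.
exact: bigcup_sup.
Qed.

Lemma freq_ge0 M : 0 <= freq I M.
Proof. by apply: sumr_ge0 => i _; apply: part_freq_ge0. Qed.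

Lemma freq_sub M M' : M \subset M' -> freq I M <= freq I M'.
Proof.
move=> MM'; rewrite /freq [leRHS](big_setID M) /= (setIidPr MM') lerDl.
by apply: sumr_ge0 => i _; apply: part_freq_ge0.
Qed.

Lemma cost_ge0 M : 0 <= cost I M.
Proof. by rewrite mulr_ge0 ?freq_ge0. Qed.

Lemma cost_sub M M' : M \subset M' -> cost I M <= cost I M'.
Proof.
move=> MM'; apply: ler_pM; rewrite ?ler0n ?freq_ge0 ?freq_sub //.
by rewrite ler_nat span_sub.
Qed.

Definition mspan (j i : nat) : nat := Defs.span I (contig N j i).
Definition mcost (j i : nat) : R := cost I (contig N j i).

(* Overlaps can be removed: the interval of [Z] covering the last index is cut
   there, the part of the covering before it is treated recursively, and cutting
   never increases a span or a cost. *)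
Lemma cover_tiled delta L n Z : (n <= N)%N ->
  (forall M, M \in Z -> contiguous M) ->
  (forall i : 'I_N, (i < n)%N -> exists2 M, M \in Z & i \in M) ->
  exists2 w, tiled mspan (fun j i => level delta L (mcost j i)) n
               (\sum_(M in Z) level delta L (cost I M)) w
           & (w <= total_space I Z)%N.
Proof.
elim/ltn_ind: n Z => -[_ Z _ _ _|m IH Z mN hZ cov].
  by exists 0%N => //; exact: tiled_nil.
have [M MZ] := cov (Ordinal mN) (ltnSn m).
have /existsP[j /existsP[i /andP[ji /eqP defM]]] := hZ M MZ.
rewrite defM inE /= => /andP[jm mi].
have sub : contig N j m \subset M.
  apply/subsetP => k; rewrite defM !inE => /andP[-> km].
  exact: leq_trans mi.
(* [M] starts at [j], so the indices below [j] are covered without it; dropping it frees its level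
   and space for [[j, m]]. *)
have [||||w t hw] := IH j _ (Z :\ M).
- by rewrite ltnS.
- exact: leq_trans jm (ltnW mN).
- by move=> M' /setD1P[_]; apply: hZ.
- move=> x xj; have [|M' M'Z xM'] := cov x; first by apply: leq_trans xj (leqW jm).
  exists M' => //; rewrite !inE M'Z andbT.
  by apply: contraTneq xM' => ->; rewrite defM inE leqNgt xj.
have lM : (level delta L (mcost j m) <= level delta L (cost I M))%N.
  by apply: level_mono; apply: cost_sub.
exists (w + mspan j m)%N.
  rewrite (big_setD1 M MZ) /=; apply: tiled_cons => //.
    exact: leq_trans lM (leq_addr _ _).
  by apply: tiled_weaken t _; move: lM; set a := (\sum_(_ in _) _)%N; lia.
rewrite /total_space (big_setD1 M MZ) /= addnC leq_add //.
exact: span_sub.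
Qed.

Lemma level_budget (eps C : R) L Z : 0 < eps -> 1 < L.+1%:R * eps ->
  total_cost I Z <= C ->
  (\sum_(M in Z) level (eps * C) L (cost I M) <= L)%N.
Proof.
move=> eps0 epsL ZC.
(* If [C <= 0], any merge in [Z] forces [C = 0] and is free, hence has level 0. Otherwise [eps * C]
   is positive and can be cancelled. *)
have [C0|C0] := leP C 0.
  rewrite big1 // => M MZ; apply/eqP; rewrite -leqn0; apply: level_leq => //.
  have [M0 tot0] : cost I M <= C /\ 0 <= C.
    move: ZC; rewrite /total_cost (big_setD1 M MZ) /= => h.
    have h0 : 0 <= \sum_(M' in Z :\ M) cost I M'.
      by apply: sumr_ge0 => *; apply: cost_ge0.
    split; apply: le_trans h; first by rewrite lerDl.
    by rewrite addr_ge0 ?cost_ge0.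
  have C00 : C = 0 by apply/eqP; rewrite eq_le C0.
  by rewrite C00 !mulr0 -C00.
have ec : 0 < eps * C by rewrite mulr_gt0.
rewrite -ltnS -(ltr_nat R) -(ltr_pM2r ec).
apply: (@le_lt_trans _ _ C); last first.
  by rewrite mulrA -[ltLHS]mul1r ltr_pM2r.
apply: le_trans ZC; rewrite natr_sum mulr_suml; apply: ler_sum => M _.
by apply: level_lb; apply: cost_ge0.
Qed.

(** Passing to the set drops repetitions, so the output intervals need not be shown distinct. *)
Lemma set_seq_sum_le (T : finType) (F : T -> R) (s : seq T) :
  (forall x, 0 <= F x) ->
  \sum_(x in [set x | x \in s]) F x <= \sum_(x <- s) F x.
Proof.
move=> F0; elim: s => [|x s IH].
  by rewrite big_nil big_pred0 // => x; rewrite !inE.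
rewrite big_cons; apply: le_trans (lerD (lexx _) IH).
have [xs|xs] := boolP (x \in s).
  rewrite -[leLHS]add0r (_ : [set y | y \in x :: s] = [set y | y \in s]) ?lerD //.
  by apply/setP => y; rewrite !inE; case: eqP => [->|].
rewrite (_ : [set y | y \in x :: s] = x |: [set y | y \in s]).
  by rewrite big_setU1 ?inE.
by apply/setP => y; rewrite !inE.
Qed.

Lemma merge_prog_correct (eps C : R) L S w :
  0 < eps -> L%:R * eps <= 1 -> 1 < L.+1%:R * eps ->
  tiled mspan (fun j i => level (eps * C) L (mcost j i)) N L w -> (w <= S)%N ->
  wp merge_prog (300 * (N.+1 ^ 2 * L.+2)) (fun s =>
    partial_output N L (eps * C) mspan mcost S 0 0 (out_merges s) /\
    (size (out_merges s) <= N)%N) (input I eps C).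
Proof.
move=> eps0 epsL epsL1 tw wS.
set T1 := (20 * L.+2)%N.
set T3 := (N.+1 * (N.+1 * (200 * L.+2) + 40))%N.
apply: (@wp_seq _ T1 (10 + (T1 + (T3 + 50 * N.+1)))); last first.
  rewrite /T1 /T3; have : (0 < N.+1 * L.+1)%N by []. nia.
apply: wp_mono (top_level_correct eps0 epsL epsL1 _ _) _ (leqnn _) => //.
move=> s [n2 n0 n1 [r0 r1] [an ar]].
apply: (@wp_seq _ 10 (T1 + (T3 + 50 * N.+1))) => //; apply: wp_rset => //.
apply: (@wp_seq _ T1 (T3 + 50 * N.+1)) => //.
apply: wp_mono (@init_correct _ N L (eps * C) mspan mcost _ _ _ _) _ (leqnn _);
  first last.
- move=> {n2 n0 n1 r0 r1 an ar}s inv.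
  apply: (@wp_seq _ T3 (50 * N.+1)) => //.
  apply: wp_mono (table_correct inv) _ (leqnn _) => {inv}s inv.
  exact: trace_correct inv tw wS.
- by move=> i k; rewrite /= an.
- by move=> k; rewrite /= ar /=; case: ifP.
- split=> //=; rewrite ?n0 ?n1 //; first by rewrite /upd /= r0 r1.
  by move=> j i jiN; rewrite ar /= jiN.
Qed.

Lemma output_correct (eps C : R) L S (s : state R) :
  0 < eps -> 0 <= C -> L%:R * eps <= 1 ->
  partial_output N L (eps * C) mspan mcost S 0 0 (out_merges s) ->
  (size (out_merges s) <= N)%N ->
  exists Z, [/\ output s Z, solution Z, (total_space I Z <= S)%N
    & total_cost I Z <= (1 + N%:R * eps) * C].
Proof.
move=> eps0 C0 epsL; set l := out_merges s => -[valid cov [w _ hw] hk] hsz.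
pose Z := [set M | M \in [seq contig N p.1 p.2 | p <- l]].
exists Z; split=> //.
- split=> [M|i].
    rewrite inE => /mapP[p pl ->].
    have /andP[p12 p2N] := allP valid p pl.
    apply/existsP; exists (Ordinal (leq_ltn_trans p12 p2N)).
    by apply/existsP; exists (Ordinal p2N); rewrite /= p12 eqxx.
  have [|p pl hp] := cov i; first by rewrite ltn_ord.
  by exists (contig N p.1 p.2); rewrite inE //; apply/mapP; exists p.
- rewrite -(ler_nat R) /total_space natr_sum.
  apply: le_trans (set_seq_sum_le _ _) _ => //.
  by rewrite big_map -natr_sum ler_nat; apply: leq_trans (leq_addr _ _) hw.
- apply: le_trans (set_seq_sum_le _ cost_ge0) _; rewrite big_map.
  (* No output interval has the default level, so [level_ub] bounds its cost. *)
  have lL p : p \in l -> (level (eps * C) L (mcost p.1 p.2) <= L)%N.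
    move=> pl; apply: leq_trans hk; rewrite (big_rem p pl) /= -!addnA.
    exact: leq_addr.
  have ec : 0 <= eps * C by rewrite mulr_ge0 // ltW.
  apply: (@le_trans _ _ ((L + N)%:R * (eps * C))).
    apply: (@le_trans _ _ (\sum_(p <- l)
        (level (eps * C) L (mcost p.1 p.2)).+1%:R * (eps * C))).
      rewrite big_seq [leRHS]big_seq; apply: ler_sum => p /lL; exact: level_ub.
    rewrite -mulr_suml ler_wpM2r // -natr_sum ler_nat.
    under eq_bigr do rewrite -addn1; rewrite big_split /= sum1_size.
    by rewrite leq_add // (leq_trans _ hk) ?leq_addr.
  by rewrite natrD mulrA mulrDl ler_wpM2r // lerD2r.
Qed.

End Merges.

(** * Combining correctness, approximation and running time *)

Lemma merge_prog_approx (R : realType) N (I : problem R N) (eps C : R) S :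
  (0 < N)%N -> 0 < eps -> is_OPT I C S ->
  exists t Z,
    [/\ returns merge_prog I eps C t Z, solution Z,
        (total_space I Z <= S)%N, total_cost I Z <= (1 + N%:R * eps) * C
      & t%:R <= 2400 * (N%:R ^+ 2 * (N%:R + eps^-1))].
Proof.
move=> N0 eps0 [[Z0 [[Z0c Z0cov] Z0C Z0S]] _].
pose L := Num.truncn eps^-1.
have /andP[L1 L2] : L%:R <= eps^-1 < L.+1%:R.
  by apply: Num.Theory.truncn_itv; rewrite invr_ge0 ltW.
have epsL : L%:R * eps <= 1 by rewrite -ler_pdivlMr // mul1r.
have epsL1 : 1 < L.+1%:R * eps by rewrite -ltr_pdivrMr // mul1r.
have C0 : 0 <= C.
  by apply: le_trans Z0C; apply: sumr_ge0 => M _; apply: cost_ge0.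
have [w t0 hw] := cover_tiled I (eps * C) L (leqnn N) Z0c (fun i _ => Z0cov i).
have tw := tiled_weaken t0 (level_budget eps0 epsL1 Z0C).
rewrite Z0S in hw.
have [t [s [es ht [po sz]]]] := merge_prog_correct eps0 epsL epsL1 tw hw.
have [Z [oZ sZ spZ cZ]] := output_correct eps0 C0 epsL po sz.
exists t, Z; split=> //; first by exists s.
(* For [N >= 1], [N.+1 ^ 2 <= 4 * N ^ 2] and [L.+2 <= 2 * (N + L)], whence 2400 = 300 * 4 * 2. *)
apply: (@le_trans _ _ (2400 * (N ^ 2 * (N + L)))%:R).
  by rewrite ler_nat (leq_trans ht) //; clear -N0; nia.
rewrite natrM ler_wpM2l ?ler0n // natrM natrX ler_wpM2l ?exprn_ge0 //.
by rewrite natrD lerD2l.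
Qed.

Theorem theorem6 (R : realType) :
  exists prog : cmd,
    (exists K : nat,
      forall (N : nat) (I : problem R N) (eps C_OPT : R) (S_OPT : nat),
        (0 < N)%N -> 0 < eps -> is_OPT I C_OPT S_OPT ->
        exists (t : nat) (Z : {set {set 'I_N}}),
          [/\ returns prog I eps C_OPT t Z,
              solution Z,
              (total_space I Z <= S_OPT)%N,
              total_cost I Z <= (1 + N%:R * eps) * C_OPT
            & t%:R <= K%:R * (N%:R ^+ 2 * (N%:R + eps^-1))]) /\
    (exists K : nat,
      forall (N : nat) (I : problem R N) (C_OPT : R) (S_OPT : nat),
        (0 < N)%N -> is_OPT I C_OPT S_OPT ->
        exists (t : nat) (Z : {set {set 'I_N}}),
          [/\ returns prog I (N%:R^-1) C_OPT t Z,
              solution Z,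
              (total_space I Z <= S_OPT)%N,
              total_cost I Z <= 2 * C_OPT
            & (t <= K * N ^ 3)%N]).
Proof.
exists merge_prog; split; first by exists 2400%N => *; exact: merge_prog_approx.
(* With [eps] equal to [1 / N] the factor [N + 1 / eps] is [2 * N], which doubles 2400. *)
exists 4800%N => N I C S N0 opt.
have N0' : 0 < N%:R :> R by rewrite ltr0n.
have [|t [Z [h1 h2 h3 h4 h5]]] := @merge_prog_approx R N I N%:R^-1 C S N0 _ opt.
  by rewrite invr_gt0.
exists t, Z; split=> //; first by move: h4; rewrite divff ?gt_eqF.
rewrite -(ler_nat R); apply: le_trans h5 _; rewrite invrK.
by rewrite -natrD -natrX -!natrM ler_nat; lia.
Qed.
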